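(* There is a constant $c>0$ such that for all positive integers $k$ and $n \geq 2^{k/2}$, there is a $K_k$-free graph $G$ on $n$ vertices such that for every subset $S$ of $n/2$ vertices of $G$, $$\Big|e(S)-\frac{1}{16}n^2\Big|<c\,2^{-k/4}n^2.$$
   Context: All graphs are finite and simple. $K_k$ denotes the complete graph on $k$ vertices, and a graph is $K_k$-free if it does not contain $K_k$ as an induced subgraph (equivalently, it contains no complete subgraph on $k$ vertices). For a set $S$ of vertices of $G$, $e(S)$ denotes the number of edges of $G$ with both endpoints in $S$. Floor and ceiling signs are systematically omitted when not crucial (so ''$n/2$ vertices'' means $\lfloor n/2\rfloor$ vertices).
   Formalization: The claim is proved for integers k ≥ 2 instead of all positive integers k; for k = 1 it is false, since every graph with a vertex contains K_1 and n ≥ 2^{1/2} forces n ≥ 2. *)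

(* Defs.v *)
(* Mathematical Components / MathComp-Analysis. *)
From HB Require Import structures.
From mathcomp Require Import all_boot all_order all_algebra.
From mathcomp Require Import reals exp.

Set Implicit Arguments.
Unset Strict Implicit.
Unset Printing Implicit Defensive.

Record sgraph (T : finType) := SGraph {
  adj :> rel T;
  adj_sym : symmetric adj;
  adj_irrefl : irreflexive adj }.

Section Graphs.
Variables (T U : finType).

Definition edges (G : sgraph T) : {set {set T}} :=
  [set [set p.1; p.2] | p in [set p : T * T | G p.1 p.2]].

Definition edges_inside (G : sgraph T) (S : {set T}) : nat :=
  #|[set A in edges G | A \subset S]|.

Definition induced_free (H : sgraph U) (G : sgraph T) : Prop :=
  ~ exists f : U -> T, injective f /\ forall x y, G (f x) (f y) = H x y.

End Graphs.

Section Complete.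
Variable k : nat.

Definition complete_rel : rel 'I_k := fun x y => x != y.

Lemma complete_rel_sym : symmetric complete_rel.
Proof. by move=> x y; rewrite /complete_rel eq_sym. Qed.

Lemma complete_rel_irrefl : irreflexive complete_rel.
Proof. by move=> x; rewrite /complete_rel eqxx. Qed.

Definition complete_graph : sgraph 'I_k :=
  SGraph complete_rel_sym complete_rel_irrefl.

End Complete.

(* Main.v *)
Require Import Defs.
From mathcomp Require Import all_boot all_order all_algebra.
From mathcomp Require Import reals sequences exp.
From mathcomp Require Import ring lra zify.
Import Order.TTheory GRing.Theory Num.Theory.
Local Open Scope ring_scope.

(** A random graph on m ~ 2^(k/2) vertices does not contain K_k, and it has
    about half of the pairs between any two vertex sets A and B, up to an error
    of order m^(3/2).  Blowing it up to n vertices (every vertex becomes an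
    independent class of about n/m vertices) creates no new clique, and scales
    the error to (n/m)^2 m^(3/2) = n^2 / sqrt m ~ 2^(-k/4) n^2.

    Random graph.  An independent fair bit is attached to every set of vertices,
    and u, v are adjacent when u <> v and the bit of {u, v} is 1.  Both
    requirements are tested by products of independent factors
    1 + a_p * (+1 or -1), whose mean is 1 (sum_prod_1Dsgb): with a_p the
    indicator of the pairs inside K, the product is 2^C(k,2) as soon as K is a
    clique (prod_clique_coeff); with a_p a small multiple of the number of times
    that the pair p is counted between A and B, it is at least exponential in
    the deviation between A and B (expR_le_prod_1Dsgb), which is the moment
    generating function proof of the Chernoff bound.  A weighted sum of all
    these products has mean at most 1, so some choice of the bits makes the sum
    at most 1 (exists_bits), and this choice meets all the requirements at once:
    see exists_free_uniform_graph.

    Blow-up.  Vertex x of 'I_n belongs to the class x %% m and to the layer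
    x %/ m.  A layer meets each class at most once, so a set S of vertices
    splits into traces S_l, each of which is a set of vertices of the small
    graph; the ordered adjacent pairs of S are counted by the sum over all pairs
    of layers of the pairs between S_l and S_l', and the estimate for the small
    graph applies to each term (edges_inside_pullback).  Controlling two
    different sets A, B rather than the edges inside a single one is what makes
    this splitting work. *)

(** * Products of independent mean-one factors *)

Definition sgb (R : pzRingType) (b : bool) : R := if b then 1 else - 1.

Lemma sum_prod_1Dsgb (R : comNzRingType) (I : finType) (a : I -> R) :
  \sum_(g : {ffun I -> bool}) \prod_i (1 + a i * sgb R (g i)) = 2 ^+ #|I|.
Proof.
rewrite -(bigA_distr_bigA (fun i b => 1 + a i * sgb R b)).
rewrite (eq_bigr (fun=> 2)); first by rewrite prodr_const.
by move=> i _; rewrite big_bool /sgb /=; ring.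
Qed.

(** First moment method: by [sum_prod_1Dsgb] the average over g of the weighted
    sum is the total weight. *)
Lemma exists_small_weighted_prod (R : realDomainType) (I J : finType)
    (w : J -> R) (a : J -> I -> R) :
    \sum_j w j <= 1 ->
  exists g : {ffun I -> bool},
    \sum_j w j * \prod_i (1 + a j i * sgb R (g i)) <= 1.
Proof.
move=> w1; pose W (g : {ffun I -> bool}) :=
  \sum_j w j * \prod_i (1 + a j i * sgb R (g i)).
have [/existsP[g Wg]|/existsPn noW] := boolP [exists g, W g <= 1].
  by exists g.
have sumW : \sum_g W g = (\sum_j w j) * 2 ^+ #|I|.
  rewrite exchange_big mulr_suml; apply: eq_bigr => j _.
  by rewrite -mulr_sumr sum_prod_1Dsgb.
have : \sum_(g : {ffun I -> bool}) 1 < \sum_g W g.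
  apply: ltr_sum => [|g _].
    by apply/hasP; exists [ffun=> true]; rewrite ?mem_index_enum.
  by rewrite ltNge; apply: noW.
rewrite sumr_const card_ffun card_bool sumW natrX => /lt_le_trans.
move=> /(_ (2 ^+ #|I|)).
by rewrite ltxx ler_piMl ?exprn_ge0// => /(_ isT).
Qed.

(** Since 1 + y <= expR y at y = 2 x^2 - x, it is enough that
    (1 + x) (1 - x + 2 x^2) = 1 + x^2 (1 + 2 x) be at least 1. *)
Lemma expR_le_1Dx (R : realType) (x : R) :
  `|x| <= 1 / 2 -> expR (x - 2 * x ^+ 2) <= 1 + x.
Proof.
rewrite ler_norml => /andP[x_ge x_le].
rewrite -[leLHS]invrK -expRN invf_ple ?posrE ?expR_gt0//; last by lra.
apply: le_trans (expR_ge1Dx _).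
rewrite -[leLHS]mul1r ler_pdivrMr; last by lra.
nra.
Qed.

(** Turns a bound on the product, which has mean 1, into a bound on the signed
    sum of the a_i: the second term is a variance, of lower order when the a_i
    are small. *)
Lemma expR_le_prod_1Dsgb (R : realType) (I : finType) (a : I -> R)
    (g : I -> bool) :
    (forall i, `|a i| <= 1 / 2) ->
  expR (\sum_i a i * sgb R (g i) - 2 * \sum_i a i ^+ 2)
    <= \prod_i (1 + a i * sgb R (g i)).
Proof.
move=> a_le; rewrite mulr_sumr -sumrB expR_sum; apply: ler_prod => i _.
rewrite expR_ge0 /=.
have -> : a i ^+ 2 = (a i * sgb R (g i)) ^+ 2 by rewrite /sgb; case: (g i); ring.
apply: expR_le_1Dx; rewrite /sgb; case: (g i); rewrite ?mulrN ?normrN mulr1;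
  exact: a_le.
Qed.

(** * Ordered and unordered pairs *)

(** Ordered pairs: an edge inside the intersection of A and B counts twice. *)
Definition edges_between {T : finType} (G : rel T) (A B : {set T}) : nat :=
  #|[set q in setX A B | G q.1 q.2]|.

Lemma set2_eq_orderings (T : finType) (u v x y : T) :
    u != v -> [set u; v] = [set x; y] ->
  (u, v) = (x, y) \/ (u, v) = (y, x).
Proof.
move=> uv uvE; have := set21 u v; have := set22 u v; rewrite uvE !inE.
by case/orP => /eqP vE /orP[]/eqP uE; move: uv; rewrite uE vE ?eqxx//; auto.
Qed.

Lemma card_ordered_pairs (T : finType) (p : {set T}) :
  #|[set q : T * T | (q.1 != q.2) && ([set q.1; q.2] == p)]|
    = ((#|p| == 2) : nat).*2.
Proof.
have [/cards2P[x [y [xy ->]]]|p2] := boolP (#|p| == 2); last first.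
  apply/eqP; rewrite cards_eq0; apply/eqP/setP => -[u v]; rewrite !inE /=.
  by apply/negP => /andP[uv /eqP pE]; rewrite -pE cards2 uv in p2.
have -> : [set q : T * T | (q.1 != q.2) && ([set q.1; q.2] == [set x; y])]
    = [set (x, y); (y, x)].
  apply/setP => -[u v]; rewrite !inE /= !xpair_eqE.
  apply/andP/orP => [[uv /eqP uvE]|[]/andP[/eqP-> /eqP->]]; last 2 first.
  - by [].
  - by rewrite eq_sym xy setUC.
  by case: (set2_eq_orderings _ _ _ _ _ uv uvE) => -[-> ->]; rewrite !eqxx; auto.
by rewrite cards2 xpair_eqE (negPf xy).
Qed.

Lemma double_edges_inside (T : finType) (G : sgraph T) (S : {set T}) :
  (edges_inside G S).*2 = edges_between G S S.
Proof.
rewrite /edges_between -sum1_card.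
rewrite (partition_big (fun q => [set q.1; q.2])
  (mem [set A in edges G | A \subset S])) /=; last first.
  move=> [u v]; rewrite !inE /= => /andP[/andP[uS vS] Guv].
  apply/andP; split; first by apply/imsetP; exists (u, v); rewrite ?inE.
  by rewrite subUset !sub1set uS.
rewrite (eq_bigr (fun=> 2%N)) => [|p]; first by rewrite sum_nat_const muln2.
rewrite !inE => /andP[/imsetP[[x y]]]; rewrite inE /= => Gxy -> pS.
have xy : x != y by apply: contraTneq Gxy => ->; rewrite adj_irrefl.
rewrite sum1_card; have <- : ((#|[set x; y]| == 2) : nat).*2 = 2%N.
  by rewrite cards2 xy.
rewrite -card_ordered_pairs; apply: eq_card => -[u v]; rewrite !inE /=.
rewrite unfold_in /= !inE /=.
have [uvE|] := eqVneq [set u; v]; last by rewrite !andbF.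
rewrite !andbT; move: pS; rewrite -uvE subUset !sub1set => ->/=.
apply/idP/idP => [Guv|uv].
  by apply: contraTneq Guv => ->; rewrite adj_irrefl.
by case: (set2_eq_orderings _ _ _ _ _ uv uvE) => -[-> ->]; rewrite // adj_sym.
Qed.

Definition pair_count {T : finType} (A B : {set T}) (p : {set T}) : nat :=
  #|[set q in setX A B | (q.1 != q.2) && ([set q.1; q.2] == p)]|.

Lemma pair_count_le2 (T : finType) (A B p : {set T}) :
  (pair_count A B p <= 2)%N.
Proof.
apply: (@leq_trans ((#|p| == 2) : nat).*2); last by case: (_ == _).
rewrite -card_ordered_pairs; apply/subset_leq_card/subsetP => q.
by rewrite !inE => /andP[].
Qed.

(** Groups the ordered pairs by their unordered pair, so that a sum of random
    signs over A x B becomes a linear combination of independent signs. *)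
Lemma sum_pair_count (R : pzRingType) (T : finType) (A B : {set T})
    (F : {set T} -> R) :
  \sum_(q in setX A B | q.1 != q.2) F [set q.1; q.2]
    = \sum_p (pair_count A B p)%:R * F p.
Proof.
rewrite (partition_big (fun q => [set q.1; q.2]) xpredT)//=.
apply: eq_bigr => p _; rewrite (eq_bigr (fun=> F p)); last first.
  by move=> q /andP[_ /eqP->].
rewrite sumr_const mulr_natl; congr (_ *+ _).
by apply: eq_card => q; rewrite !inE unfold_in/= !inE andbA.
Qed.

Lemma sum_pair_count_le (T : finType) (A B : {set T}) :
  (\sum_p pair_count A B p <= #|T| ^ 2)%N.
Proof.
rewrite -(@ler_nat int) natr_sum.
under eq_bigr do rewrite -[_%:R]mulr1.
rewrite -(sum_pair_count int _ A B (fun=> 1)) sumr_const ler_nat.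
rewrite (leq_trans (max_card _))//.
by rewrite card_prod.
Qed.

(** * The graph defined by a family of bits *)

Section BitGraph.
Variables (T : finType) (g : {set T} -> bool).

Definition bit_rel : rel T := fun u v => (u != v) && g [set u; v].

Lemma bit_rel_sym : symmetric bit_rel.
Proof. by move=> u v; rewrite /bit_rel eq_sym setUC. Qed.

Lemma bit_rel_irrefl : irreflexive bit_rel.
Proof. by move=> u; rewrite /bit_rel eqxx. Qed.

Definition bit_graph : sgraph T := SGraph bit_rel_sym bit_rel_irrefl.

(** Twice an adjacency bit is 1 plus a sign, so the deviation is a sum of signs,
    except for the diagonal pairs (u, u), which are at most #|T| in number. *)
Lemma edges_between_bit_graph (R : realDomainType) (A B : {set T}) :
  `|2 * (edges_between bit_graph A B)%:R - #|A|%:R * #|B|%:R|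
    <= #|T|%:R + `|\sum_p (pair_count A B p)%:R * sgb R (g p)|.
Proof.
rewrite -sum_pair_count.
have -> : (edges_between bit_graph A B)%:R
    = \sum_(q in setX A B | q.1 != q.2) (g [set q.1; q.2])%:R :> R.
  rewrite /edges_between -sum1_card natr_sum big_mkcond [RHS]big_mkcond /=.
  apply: eq_bigr => q _; rewrite inE /bit_rel /=.
  by case: (q \in _) (q.1 != q.2) (g _) => -[] [].
have -> : #|A|%:R * #|B|%:R = (\sum_(q in setX A B | q.1 == q.2) 1)
    + \sum_(q in setX A B | q.1 != q.2) 1 :> R.
  by rewrite -natrM -cardsX -bigID/= sumr_const.
rewrite opprD addrCA mulr_sumr -sumrB.
rewrite [X in - _ + X](eq_bigr (fun q => sgb R (g [set q.1; q.2]))); last first.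
  by move=> q _; rewrite /sgb; case: (g _) => /=; ring.
apply: le_trans (ler_normD _ _) _; rewrite lerD2r normrN sumr_const.
rewrite ger0_norm ?ler0n// ler_nat.
rewrite -(@card_in_imset _ _ fst); first exact: max_card.
move=> [u v] [u' v']; rewrite !unfold_in /= => /andP[_ /eqP<-] /andP[_ /eqP<-].
by move=> /= ->.
Qed.

End BitGraph.

Lemma complete_image_bits (T : finType) (g : {set T} -> bool) (k : nat)
    (f : 'I_k -> T) (p : {set T}) :
    (forall i j, bit_graph _ g (f i) (f j) = complete_graph k i j) ->
  p \subset f @: 'I_k -> #|p| == 2 -> g p.
Proof.
move=> fG /subsetP pK /cards2P[x [y [xy pE]]].
have /imsetP[i _ xE] : x \in f @: 'I_k by apply: pK; rewrite pE set21.
have /imsetP[j _ yE] : y \in f @: 'I_k by apply: pK; rewrite pE set22.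
have := fG i j; rewrite /= /complete_rel /bit_rel -xE -yE -pE xy /= => ->.
by apply: contraNneq xy => ij; rewrite xE yE ij.
Qed.

(** * Choosing the bits *)

(** The index is a sign and two sets A, B; the sign makes the same upper bound
    control the deviation between A and B on both sides.  The scale d is of
    order 1 / sqrt #|T|. *)
Definition disc_coeff {R : realType} {T : finType} (d : R)
    (j : bool * {set T} * {set T}) (p : {set T}) : R :=
  d * sgb R j.1.1 * (pair_count j.1.2 j.2 p)%:R.

Lemma disc_coeff_bound (R : realType) (T : finType) (d : R) j (p : {set T}) :
  0 <= d -> d <= 1 / 4 -> `|disc_coeff d j p| <= 1 / 2.
Proof.
move=> d0 d4; rewrite /disc_coeff !normrM (ger0_norm d0) normr_nat.
have -> : `|sgb R j.1.1| = 1 by rewrite /sgb; case: ifP; rewrite ?normrN normr1.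
have : (pair_count j.1.2 j.2 p)%:R <= 2 :> R by rewrite ler_nat pair_count_le2.
have : 0 <= (pair_count j.1.2 j.2 p)%:R :> R by [].
nra.
Qed.

Lemma sum_disc_coeff_sqr (R : realType) (T : finType) (d : R) j :
  \sum_(p : {set T}) disc_coeff d j p ^+ 2 <= 2 * d ^+ 2 * #|T|%:R ^+ 2.
Proof.
apply: (@le_trans _ _
  (\sum_(p : {set T}) 2 * d ^+ 2 * (pair_count j.1.2 j.2 p)%:R)).
  apply: ler_sum => p _; rewrite /disc_coeff.
  have -> : (d * sgb R j.1.1 * (pair_count j.1.2 j.2 p)%:R) ^+ 2
      = d ^+ 2 * (pair_count j.1.2 j.2 p)%:R ^+ 2.
    by rewrite /sgb; case: (j.1.1); ring.
  (* A pair count c is at most 2, so that c^2 <= 2 c. *)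
  rewrite [leRHS]mulrAC [leRHS]mulrC; apply: ler_wpM2l; first exact: sqr_ge0.
  by rewrite expr2; apply: ler_wpM2r => //; rewrite ler_nat pair_count_le2.
rewrite -mulr_sumr -natr_sum -natrX; apply: ler_wpM2l.
  by rewrite mulr_ge0 ?sqr_ge0.
by rewrite ler_nat sum_pair_count_le.
Qed.

Definition clique_coeff (R : realType) {T : finType} (K p : {set T}) : R :=
  ((p \subset K) && (#|p| == 2))%:R.

Lemma prod_clique_coeff (R : realType) (T : finType) (g : {set T} -> bool)
    (K : {set T}) :
    (forall p : {set T}, p \subset K -> #|p| == 2 -> g p) ->
  \prod_p (1 + clique_coeff R K p * sgb R (g p)) = 2 ^+ 'C(#|K|, 2).
Proof.
move=> gK; rewrite (bigID (fun p : {set T} => (p \subset K) && (#|p| == 2)))/=.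
rewrite [X in _ * X]big1 ?mulr1 => [|p /negPf pK]; last first.
  by rewrite /clique_coeff pK mul0r addr0.
rewrite (eq_bigr (fun=> 2)) => [|p /andP[pK p2]]; last first.
  by rewrite /clique_coeff pK p2 /sgb gK//= mulr1.
rewrite prodr_const -cards_draws; congr (_ ^+ _).
by apply: eq_card => p; rewrite !inE.
Qed.

(** The weights give total mass at most 1/2 to the 2 * 4^#|T| deviation products
    and at most 1/2 to the k-sets.  A clique K would contribute 1 by itself, and
    the deviation products are positive, so the sum could not be at most 1. *)
Lemma exists_bits (R : realType) (T : finType) (k : nat) (d : R) :
    0 <= d -> d <= 1 / 4 -> (('C(#|T|, k)).*2 <= 2 ^ 'C(k, 2))%N ->
  exists g : {ffun {set T} -> bool},
    (forall K : {set T}, #|K| = k ->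
       ~ forall p : {set T}, p \subset K -> #|p| == 2 -> g p) /\
    forall j, \prod_p (1 + disc_coeff d j p * sgb R (g p)) <= 4 * 4 ^+ #|T|.
Proof.
move=> d0 d4 kT; pose J : finType := (bool * {set T} * {set T})%type.
pose w (j : (J + {set T})%type) : R := match j with
  | inl _ => (4 * 4 ^+ #|T|)^-1
  | inr K => (#|K| == k)%:R * (2 ^+ 'C(k, 2))^-1 end.
pose a (j : (J + {set T})%type) : {set T} -> R := match j with
  | inl j => disc_coeff d j
  | inr K => clique_coeff R K end.
have w_ge0 j : 0 <= w j.
  by case: j => [j|K]; rewrite /= ?mulr_ge0// invr_ge0 ?mulr_ge0// exprn_ge0.
have cardJ : #|{: J}|%:R = 2 * 4 ^+ #|T| :> R.
  have cardsetT : #|{set T}| = (2 ^ #|T|)%N.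
    rewrite -[in RHS]cardsT -card_powerset powersetT.
    by apply: eq_card => A; rewrite !inE.
  rewrite !card_prod card_bool cardsetT -mulnA -expnMn natrM natrX.
  by congr (_ * _ ^+ _).
have [] := @exists_small_weighted_prod R {set T} (J + {set T})%type w a.
  have sumJ x : \sum_(j : J) x = 2 * 4 ^+ #|T| * x :> R.
    by rewrite sumr_const -cardJ mulr_natl.
  rewrite big_sumType /= sumJ -mulr_suml -natr_sum.
  have -> : (\sum_(K : {set T}) (#|K| == k))%N = 'C(#|T|, k).
    rewrite -card_draws -sum1_card [RHS]big_mkcond /=.
    by apply: eq_bigr => K _; rewrite inE; case: eqP.
  have e1 : 0 < 4 ^+ #|T| :> R by rewrite exprn_gt0.
  have e2 : 0 < 2 ^+ 'C(k, 2) :> R by rewrite exprn_gt0.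
  have -> : 2 * 4 ^+ #|T| / (4 * 4 ^+ #|T|) = 1 / 2 :> R.
    by field; rewrite gt_eqF.
  have : ('C(#|T|, k))%:R / 2 ^+ 'C(k, 2) <= 1 / 2 :> R.
    rewrite ler_pdivrMr// mulrAC ler_pdivlMr// mul1r -natrM muln2 -natrX.
    by rewrite ler_nat.
  lra.
move=> g gsmall; exists g.
have prod_gt0 j : 0 < \prod_p (1 + disc_coeff d j p * sgb R (g p)).
  apply: lt_le_trans (expR_gt0 _) (expR_le_prod_1Dsgb _ _ _ _ _) => p.
  exact: disc_coeff_bound.
have term_ge0 (j : (J + {set T})%type) :
    0 <= w j * \prod_p (1 + a j p * sgb R (g p)).
  apply: mulr_ge0 => //; case: j => [j|K] /=; first exact: ltW.
  apply: prodr_ge0 => p _; rewrite /clique_coeff /sgb.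
  by case: (_ && _) (g p) => -[] /=; lra.
split=> [K Kk gK|j].
- move: gsmall; apply/negP; rewrite -ltNge big_sumType /=.
  rewrite (bigD1 (true, set0, set0))//= [X in _ + X](bigD1 K)//=.
  rewrite [X in _ + (X + _)](_ : _ = 1); last first.
    rewrite Kk eqxx mul1r prod_clique_coeff// Kk mulVf//.
    by rewrite expf_neq0// pnatr_eq0.
  have : 0 < (4 * 4 ^+ #|T|)^-1
      * \prod_p (1 + disc_coeff d (true, set0, set0) p * sgb R (g p)).
    by rewrite mulr_gt0// invr_gt0 mulr_gt0// exprn_gt0.
  have := sumr_ge0 _
    (fun (j : J) (_ : j != (true, set0, set0)) => term_ge0 (inl j)).
  have := sumr_ge0 _ (fun (L : {set T}) (_ : L != K) => term_ge0 (inr L)).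
  move=> /= /(_ (index_enum _)) restK /(_ (index_enum _)) restJ; lra.
- have : w (inl j) * \prod_p (1 + a (inl j) p * sgb R (g p)) <= 1.
    apply: le_trans gsmall; rewrite [leRHS](bigD1 (inl j))//= lerDl.
    exact: sumr_ge0.
  by rewrite /= ler_pdivrMl ?mulr1// mulr_gt0// exprn_gt0.
Qed.

(** The logarithm of 4 * 4^m is at most 4 m, and for d = 1 / (4 sqrt m) the
    variance term is at most m / 4; hence d times the sum of signs is at most
    17/4 m. *)
Lemma sign_sum_le (R : realType) (T : finType) (g : {set T} -> bool) :
    (0 < #|T|)%N ->
    (forall j, \prod_p (1 + disc_coeff ((4 * Num.sqrt #|T|%:R)^-1) j p
                            * sgb R (g p)) <= 4 * 4 ^+ #|T|) ->
  forall A B : {set T}, `|\sum_p (pair_count A B p)%:R * sgb R (g p)|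
    <= 17 * (#|T|%:R * Num.sqrt #|T|%:R).
Proof.
move=> T_gt0; set m := #|T| in T_gt0 *; set r : R := Num.sqrt m%:R.
set d := (4 * r)^-1 => prod_le A B.
have r2 : r ^+ 2 = m%:R by rewrite sqr_sqrtr.
have r_gt0 : 0 < r by rewrite sqrtr_gt0 ltr0n.
have r_ge1 : 1 <= r by rewrite -[1]sqrtr1 ler_wsqrtr// ler1n.
have d_gt0 : 0 < d by rewrite invr_gt0 mulr_gt0.
have dr : d * (4 * r) = 1 by rewrite mulVf// gt_eqF// mulr_gt0.
have d_le : d <= 1 / 4 by nra.
have le_expR : 4 * 4 ^+ m <= expR (4 * m%:R) :> R.
  apply: (@le_trans _ _ (16 ^+ m)).
    rewrite [16](_ : _ = 4 * 4); last by ring.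
    by rewrite exprMn ler_wpM2r ?exprn_ge0// ler_eXnr// ler1n.
  rewrite expRM_natr lerXn2r ?nnegrE ?expR_ge0//.
  rewrite -[4 in leRHS]mulr1 expRM_natl.
  rewrite [leLHS](_ : _ = 2 ^+ 4); last by ring.
  rewrite lerXn2r ?nnegrE ?expR_ge0//.
  by apply: le_trans (expR_ge1Dx 1); rewrite lexx.
have signed_le s : sgb R s * (\sum_p (pair_count A B p)%:R * sgb R (g p))
    <= 17 * (m%:R * r).
  pose j := (s, A, B).
  have coeff_le p : `|disc_coeff d j p| <= 1 / 2.
    exact: disc_coeff_bound (ltW d_gt0) d_le.
  have := le_trans (expR_le_prod_1Dsgb _ _ _ g coeff_le) (prod_le j).
  move=> /le_trans/(_ le_expR).
  rewrite ler_expR lerBlDr.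
  have -> : \sum_p disc_coeff d j p * sgb R (g p) =
      d * (sgb R s * \sum_p (pair_count A B p)%:R * sgb R (g p)).
    by rewrite !mulr_sumr; apply: eq_bigr => p _; rewrite /disc_coeff/=; ring.
  set E := sgb R s * _ => dE.
  have := sum_disc_coeff_sqr R T d j; rewrite -/m => sqr_le.
  have {}sqr_le : 2 * \sum_p disc_coeff d j p ^+ 2 <= m%:R / 4.
    have : (d * (4 * r)) ^+ 2 = 1 by rewrite dr expr1n.
    rewrite !exprMn r2 => d2.
    have -> : m%:R / 4 = 2 * (2 * d ^+ 2 * m%:R ^+ 2) :> R.
      by rewrite -[LHS]mulr1 -[X in _ * X = _]d2; field.
    lra.
  have {dE sqr_le} : d * E <= 17 / 4 * m%:R by lra.
  rewrite -(ler_pM2r (_ : 0 < 4 * r)) ?mulr_gt0// mulrAC dr mul1r.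
  by move=> /le_trans; apply; rewrite le_eqVlt; apply/orP; left; apply/eqP; field.
rewrite ler_norml; have := signed_le true; have := signed_le false.
rewrite /sgb; lra.
Qed.

Lemma exists_free_uniform_graph (R : realType) (T : finType) (k : nat) :
    (0 < #|T|)%N -> (('C(#|T|, k)).*2 <= 2 ^ 'C(k, 2))%N ->
  exists G : sgraph T, induced_free (complete_graph k) G /\
    forall A B : {set T},
      `|2 * (edges_between G A B)%:R - #|A|%:R * #|B|%:R|
        <= 18 * (#|T|%:R * Num.sqrt #|T|%:R) :> R.
Proof.
move=> T_gt0 kT; set r : R := Num.sqrt _.
have r_ge1 : 1 <= r by rewrite -[1]sqrtr1 ler_wsqrtr// ler1n.
have d_ge0 : 0 <= (4 * r)^-1 by rewrite invr_ge0; lra.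
have d_le : (4 * r)^-1 <= 1 / 4.
  by rewrite mul1r lef_pV2 ?posrE//; lra.
have [g [g_free g_disc]] := exists_bits R T k _ d_ge0 d_le kT.
exists (bit_graph _ g); split=> [[f [f_inj fG]]|A B].
- apply: (g_free (f @: 'I_k)) => [|p]; first by rewrite card_imset ?card_ord.
  exact: complete_image_bits fG.
apply: le_trans (edges_between_bit_graph _ _ _ _ _) _.
have := sign_sum_le R T g T_gt0 g_disc A B; rewrite -/r.
have : 0 <= #|T|%:R :> R by [].
nra.
Qed.

(** * Blow-ups *)

(** The fibres of P are independent sets: G being irreflexive, two vertices
    with the same image are never adjacent. *)
Definition pullback_rel {T U : finType} (P : U -> T) (G : sgraph T) : rel U :=
  fun x y => G (P x) (P y).

Lemma pullback_sym (T U : finType) (P : U -> T) (G : sgraph T) :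
  symmetric (pullback_rel P G).
Proof. by move=> x y; exact: adj_sym. Qed.

Lemma pullback_irrefl (T U : finType) (P : U -> T) (G : sgraph T) :
  irreflexive (pullback_rel P G).
Proof. by move=> x; exact: adj_irrefl. Qed.

Definition pullback {T U : finType} (P : U -> T) (G : sgraph T) : sgraph U :=
  SGraph (pullback_sym T U P G) (pullback_irrefl T U P G).

(** A clique meets each fibre of P at most once, so P maps it onto a clique. *)
Lemma induced_free_pullback (T U : finType) (P : U -> T) (G : sgraph T) k :
  induced_free (complete_graph k) G ->
  induced_free (complete_graph k) (pullback P G).
Proof.
move=> Gfree [f [_ fG]]; apply: Gfree; exists (P \o f); split=> // i j /= Pij.
apply/eqP; apply: contraFT (adj_irrefl G (P (f i))) => ij.
by rewrite {2}Pij -[G _ _]/(pullback P G (f i) (f j)) fG.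
Qed.

Lemma edges_betweenE (T : finType) (G : rel T) (A B : {set T}) :
  edges_between G A B = (\sum_(x in A) \sum_(y in B) G x y)%N.
Proof.
rewrite pair_big /edges_between -sum1_card big_mkcond [RHS]big_mkcond /=.
apply: eq_bigr => -[x y] _; rewrite !inE /=.
by case: (x \in A) (y \in B) (G x y) => -[] [].
Qed.

(* P and the layer together determine a vertex: the layers are partial
   transversals of the fibres of P. *)
Section Layers.
Variables (R : realDomainType) (T U L : finType) (P : U -> T) (layer : U -> L).
Hypothesis P_inj :
  forall x y, layer x = layer y -> P x = P y -> x = y.

Let trace (S : {set U}) (l : L) : {set T} := P @: [set x in S | layer x == l].

Lemma sum_layers (S : {set U}) (F : T -> nat) :
  (\sum_(x in S) F (P x) = \sum_l \sum_(u in trace S l) F u)%N.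
Proof.
rewrite (partition_big layer xpredT)//=; apply: eq_bigr => l _.
rewrite /trace big_imset => [|x y]; first by apply: eq_bigl => x; rewrite inE.
by rewrite !inE => /andP[_ /eqP xl] /andP[_ /eqP yl]; apply: P_inj; rewrite xl.
Qed.

(** P identifies each layer of S with its trace, so that the ordered adjacent
    pairs of S are distributed over #|L|^2 pairs of traces. *)
Lemma edges_inside_pullback (G : sgraph T) (E : R) :
    (forall A B : {set T},
       `|2 * (edges_between G A B)%:R - #|A|%:R * #|B|%:R| <= E) ->
  forall S : {set U},
    `|4 * (edges_inside (pullback P G) S)%:R - #|S|%:R ^+ 2|
      <= #|L|%:R ^+ 2 * E.
Proof.
move=> GE S.
have -> : 4 * (edges_inside (pullback P G) S)%:R
    = \sum_l \sum_l' 2 * (edges_between G (trace S l) (trace S l'))%:R :> R.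
  have -> : 4 * (edges_inside (pullback P G) S)%:R
      = 2 * (edges_between (pullback P G) S S)%:R :> R.
    by rewrite -double_edges_inside -muln2 natrM; ring.
  under eq_bigr do rewrite -mulr_sumr -natr_sum.
  rewrite -mulr_sumr -natr_sum edges_betweenE; congr (2 * _%:R).
  rewrite (sum_layers S (fun u => \sum_(y in S) G u (P y))%N).
  apply: eq_bigr => l _; under [RHS]eq_bigr do rewrite edges_betweenE.
  rewrite [RHS]exchange_big /=; apply: eq_bigr => u _.
  exact: (sum_layers S (fun v => G u v)).
have -> : #|S|%:R ^+ 2
    = \sum_l \sum_l' #|trace S l|%:R * #|trace S l'|%:R :> R.
  have -> : #|S|%:R = \sum_l #|trace S l|%:R :> R.
    rewrite -natr_sum -sum1_card (sum_layers S (fun=> 1%N)).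
    by congr _%:R; apply: eq_bigr => l _; rewrite sum1_card.
  by rewrite expr2 mulr_suml; apply: eq_bigr => l _; rewrite mulr_sumr.
rewrite -sumrB; apply: le_trans (ler_norm_sum _ _ _) _.
apply: (@le_trans _ _ (\sum_(l : L) \sum_(l' : L) E)).
  apply: ler_sum => l _; rewrite -sumrB; apply: le_trans (ler_norm_sum _ _ _) _.
  by apply: ler_sum => l' _.
by rewrite !sumr_const -mulrnA -[leLHS]mulr_natl natrM expr2.
Qed.

End Layers.

(** * Choice of parameters *)

(** For k >= 2 and m = 2^j, 2 C(m, k) <= k! C(m, k) <= m^k = 2^(j k), and
    j <= (k - 1) / 2: at most half of the graphs on m vertices contain K_k. *)
Lemma double_bin_le (j k : nat) :
  (2 <= k)%N -> (j.*2 < k)%N -> (('C(2 ^ j, k)).*2 <= 2 ^ 'C(k, 2))%N.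
Proof.
move=> k2 jk; rewrite -muln2.
have k_fact : (2 <= k`!)%N.
  by rewrite -[2%N]/(2`!)%N; apply: leq_fact.
apply: (@leq_trans ('C(2 ^ j, k) * k`!)); first by rewrite leq_mul2l k_fact orbT.
rewrite bin_ffact ffact_prod.
apply: (@leq_trans ((2 ^ j) ^ k)).
  rewrite -[X in (_ <= _ ^ X)%N]card_ord -prod_nat_const.
  by apply: leq_prod => i _; exact: leq_subr.
rewrite -expnM leq_exp2l// bin2.
have -> : (j * k)%N = ((k * j.*2)./2)%N by rewrite -doubleMr doubleK mulnC.
rewrite half_leq// leq_mul2l; apply/orP; right.
by rewrite -ltnS prednK// (leq_trans _ k2).
Qed.

(* k = 1 is excluded: no graph with a vertex is K_1-free, so the claim fails
   there for every n >= 2^(1/2).  The sets S have floor(n/2) vertices. *)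
Theorem proposition4p5 (R : realType) :
  exists c : R, 0 < c /\
    forall k n : nat, (2 <= k)%N -> 2 `^ (k%:R / 2) <= n%:R :> R ->
      exists G : sgraph 'I_n,
        induced_free (complete_graph k) G /\
        forall S : {set 'I_n}, #|S| = n./2 ->
          `| (edges_inside G S)%:R - 1 / 16 * n%:R ^+ 2 |
            < c * 2 `^ (- (k%:R / 4)) * n%:R ^+ 2 :> R.
Proof.
exists 37; split=> // k n k2 nk.
(* The largest power of two with m^2 <= 2^(k-1). *)
pose j := (k.-1)./2; pose m := (2 ^ j)%N.
have j_lt : (j.*2 < k)%N by rewrite /j; lia.
have k_le : (k <= j.*2 + 2)%N by rewrite /j; lia.
have m_gt0 : (0 < m)%N by rewrite expn_gt0.
have m_sqr : (m ^ 2 <= 2 ^ k)%N by rewrite -expnM muln2 leq_exp2l// ltnW.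
have k_exp : (2 ^ k <= 4 * m ^ 2)%N.
  by rewrite -expnM muln2 mulnC -[4%N]/(2 ^ 2)%N -expnD leq_exp2l.
have mn : (m <= n)%N.
  rewrite -leq_sqr (leq_trans m_sqr)// -(ler_nat R) !natrX.
  have -> : 2 ^+ k = (2 `^ (k%:R / 2)) ^+ 2 :> R.
    by rewrite -[RHS]powR_mulrn ?powR_ge0// -powRrM divfK ?pnatr_eq0// powR_mulrn.
  by rewrite lerXn2r// ?nnegrE ?powR_ge0.
set t : R := 2 `^ _.
have t_gt0 : 0 < t by rewrite powR_gt0.
have t4 : t ^+ 4 * 2 ^+ k = 1.
  rewrite -powR_mulrn ?powR_ge0// -powRrM -powR_mulrn// -powRD ?pnatr_eq0 ?implybT//.
  by rewrite mulNr divfK ?pnatr_eq0// addNr powRr0.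
have := exists_free_uniform_graph R 'I_m k; rewrite card_ord.
case=> [//||G [G_free G_unif]]; first exact: double_bin_le.
set r : R := Num.sqrt _ in G_unif.
have r2 : r ^+ 2 = m%:R by rewrite sqr_sqrtr.
have r_ge0 : 0 <= r by rewrite sqrtr_ge0.
(* That is, 1 / sqrt m <= 2 * 2^(-k/4), because 2^k <= 4 m^2. *)
have tr : 1 <= 2 * t * r.
  rewrite -(@expr_ge1 _ 4) ?mulr_ge0// ?(ltW t_gt0)// -[leLHS]t4.
  have -> : (2 * t * r) ^+ 4 = t ^+ 4 * (16 * (r ^+ 2) ^+ 2) by ring.
  rewrite r2 ler_wpM2l ?exprn_ge0 ?(ltW t_gt0)// -!natrX -natrM ler_nat.
  by rewrite (leq_trans k_exp)// leq_mul2r orbT.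
have modm (x : 'I_n) : (x %% m < m)%N by rewrite ltn_mod.
have divm (x : 'I_n) : (x %/ m < (n %/ m).+1)%N.
  by rewrite ltnS leq_div2r// ltnW.
pose part x := Ordinal (modm x); pose layer x := Ordinal (divm x).
have part_inj x y : layer x = layer y -> part x = part y -> x = y.
  move=> [xyd] [xym]; apply: val_inj.
  by rewrite /= (divn_eq x m) xyd xym -divn_eq.
exists (pullback part G); split; first exact: induced_free_pullback.
move=> S S_half.
have := edges_inside_pullback R _ _ _ part layer part_inj G _ G_unif S.
rewrite card_ord S_half; set e := (edges_inside _ _)%:R; set W := (n %/ m).+1.
have Wm : (W * m <= 2 * n)%N.
  by rewrite /W mulSn mul2n -addnn leq_add// leq_divM.
have Wm2 : (W%:R * m%:R) ^+ 2 <= 4 * n%:R ^+ 2 :> R.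
  by rewrite -natrM -!natrX -natrM ler_nat -[4%N]/(2 ^ 2)%N -expnMn leq_sqr.
have dev : W%:R ^+ 2 * (18 * (m%:R * r)) <= 144 * t * n%:R ^+ 2.
  apply: (@le_trans _ _ (W%:R ^+ 2 * (18 * (m%:R * r)) * (2 * t * r))).
    by rewrite ler_peMr// !mulr_ge0.
  (* One factor r comes from the deviation, the other from 2 t r >= 1. *)
  have -> : W%:R ^+ 2 * (18 * (m%:R * r)) * (2 * t * r)
      = 36 * t * (W%:R * m%:R) ^+ 2 by rewrite -r2; ring.
  have -> : 144 * t * n%:R ^+ 2 = 36 * t * (4 * n%:R ^+ 2) by ring.
  by rewrite ler_wpM2l// mulr_ge0// ltW.
have n_ge1 : 1 <= n%:R :> R by rewrite ler1n (leq_trans m_gt0).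
have rn : r <= n%:R.
  apply: (@le_trans _ _ m%:R); last by rewrite ler_nat.
  rewrite -r2 expr2 ler_peMr//.
  by rewrite -[1]sqrtr1 ler_wsqrtr// ler1n.
(* Replacing n^2 / 4 by the square of floor(n/2) costs at most n / 2, which is
   also of order t n^2. *)
have tn : n%:R <= 2 * t * n%:R ^+ 2.
  have : 1 <= 2 * t * n%:R.
    by apply: le_trans tr _; rewrite ler_wpM2l ?mulr_ge0// ltW.
  nra.
have half_le : 2 * (n./2)%:R <= n%:R :> R.
  by rewrite -natrM ler_nat; lia.
have half_ge : n%:R <= 2 * (n./2)%:R + 1 :> R.
  by rewrite -natrM natr1 ler_nat; lia.
have tnn : 0 < t * n%:R ^+ 2.
  by rewrite mulr_gt0// exprn_gt0// (lt_le_trans _ n_ge1).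
have half_sqr_le : 4 * (n./2)%:R ^+ 2 <= n%:R ^+ 2 :> R.
  have : 0 <= (n./2)%:R :> R by [].
  nra.
have half_sqr_ge : n%:R ^+ 2 - 2 * n%:R <= 4 * (n./2)%:R ^+ 2 :> R by nra.
move=> /le_trans/(_ dev); rewrite ler_norml ltr_norml => /andP[e_ge e_le].
apply/andP; split; nra.
Qed.
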